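(* The Killing-max property holds for the root system $G_2$: for all $\lambda,Y\in\overline{\mathfrak a^+}$ and all $w\in W$, $$\langle\lambda,w\cdot Y\rangle=\langle\lambda,Y\rangle\iff w\in W_\lambda\,W_Y .$$
   Context: For the root system $G_2$: $\mathfrak a=\{h_{A,B}=(A,B,A-B):A,B\in\mathbb R\}\subset\mathbb R^3$ with (up to a positive factor) the scalar product induced from $\mathbb R^3$; the simple roots are $\alpha(h_{A,B})=A-B$ and $\beta(h_{A,B})=2B-A$; the Weyl group $W$ (of order 12) is generated by $s_\alpha$, which interchanges the first two entries and changes the sign of the third, and $s_\beta$, which interchanges the second and third entries; $\overline{\mathfrak a^+}=\{h_{A,B}:A\ge B\ge A-B\ge0\}$ is the closed positive Weyl chamber. For $X\in\mathfrak a$, $W_X=\{w\in W:w\cdot X=X\}$; $W_\lambda W_Y=\{uv:u\in W_\lambda,v\in W_Y\}$. *)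

(* Defs.v *)
From HB Require Import structures.
From mathcomp Require Import all_boot all_order all_algebra.
From mathcomp Require Import classical_sets reals.
From mathcomp Require Import ring lra zify.

Set Implicit Arguments.
Unset Strict Implicit.
Unset Printing Implicit Defensive.

Import Order.TTheory GRing.Theory Num.Theory.
Local Open Scope ring_scope.
Local Open Scope classical_set_scope.

Section G2.
Variable R : realType.
Implicit Types (X Y : 'cV[R]_3) (u v w : 'M[R]_3).

Definition col3 (x y z : R) : 'cV[R]_3 := \col_i [:: x; y; z]`_i.

Definition mx3 (r0 r1 r2 : seq R) : 'M[R]_3 :=
  \matrix_(i, j) (nth [::] [:: r0; r1; r2] i)`_j.

Definition hG2 (A B : R) : 'cV[R]_3 := col3 A B (A - B).

Definition aG2 : set 'cV[R]_3 := [set X | exists A B, X = hG2 A B].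

Definition ip (c : R) X Y : R := c * \sum_(i < 3) X i 0 * Y i 0.

Definition s_alpha : 'M[R]_3 :=
  mx3 [:: 0; 1;  0]
      [:: 1; 0;  0]
      [:: 0; 0; -1].

Definition s_beta : 'M[R]_3 :=
  mx3 [:: 1; 0; 0]
      [:: 0; 0; 1]
      [:: 0; 1; 0].

Definition subgroup_GL (G : set 'M[R]_3) : Prop :=
  [/\ forall u, G u -> u \in unitmx,
      G 1%:M,
      forall u v, G u -> G v -> G (u *m v)
    & forall u, G u -> G (invmx u)].

(* The Weyl group, as the subgroup of GL_3(R) generated by the two simple
   reflections, whose formulas make sense on all of R^3. This group preserves
   [aG2] and acts faithfully on it (lemmas [weyl_stable] and [weyl_faithful]),
   so an element of it is the same thing as its restriction to [aG2]. *)
Definition weyl : set 'M[R]_3 := smallest subgroup_GL [set s_alpha; s_beta].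

Definition closed_chamber : set 'cV[R]_3 :=
  [set X | exists A B, X = hG2 A B /\ [/\ A >= B, B >= A - B & A - B >= 0]].

Definition stab X : set 'M[R]_3 := [set w | weyl w /\ w *m X = X].

Definition mulset (U V : set 'M[R]_3) : set 'M[R]_3 :=
  [set u *m v | u in U & v in V].

Lemma s_alphaE x y z : s_alpha *m col3 x y z = col3 y x (- z).
Proof.
apply/matrixP=> i j; rewrite !mxE !big_ord_recl big_ord0 !mxE /=.
by case: i => [[|[|[|//]]]] ? /=; ring.
Qed.

Lemma s_betaE x y z : s_beta *m col3 x y z = col3 x z y.
Proof.
apply/matrixP=> i j; rewrite !mxE !big_ord_recl big_ord0 !mxE /=.
by case: i => [[|[|[|//]]]] ? /=; ring.
Qed.

Lemma col3P X : exists x y z, X = col3 x y z.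
Proof.
exists (X 0 0), (X 1 0), (X (inord 2) 0); apply/matrixP=> i j.
rewrite ord1 !mxE; case: i => [[|[|[|//]]]] ? /=; congr (X _ _);
by apply: val_inj; rewrite //= inordK.
Qed.

Lemma mulmx_col_inj u v : (forall X, u *m X = v *m X) -> u = v.
Proof.
by move=> uv; apply/matrixP=> i j; have := uv (delta_mx j 0);
   rewrite -!colE => /matrixP/(_ i 0); rewrite !mxE.
Qed.

Lemma s_alphaK : s_alpha *m s_alpha = 1%:M.
Proof.
apply: mulmx_col_inj => X; have [x [y [z ->]]] := col3P X.
by rewrite -mulmxA !s_alphaE opprK mul1mx.
Qed.

Lemma s_betaK : s_beta *m s_beta = 1%:M.
Proof.
apply: mulmx_col_inj => X; have [x [y [z ->]]] := col3P X.
by rewrite -mulmxA !s_betaE mul1mx.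
Qed.

Lemma invol_unitmx u : u *m u = 1%:M -> u \in unitmx /\ invmx u = u.
Proof.
move=> uu; have [uU _] := mulmx1_unit uu; split=> //.
by rewrite -[RHS]mul1mx -(mulVmx uU) -mulmxA uu mulmx1.
Qed.

Lemma weyl_ind (P : set 'M[R]_3) :
  P 1%:M -> P s_alpha -> P s_beta ->
  (forall u v, P u -> P v -> P (u *m v)) -> weyl `<=` P.
Proof.
move=> P1 Pa Pb PM w Ww.
suff [] : [set u | [/\ u \in unitmx, P u & P (invmx u)]] w by [].
apply: Ww; split; [split|] => /=.
- by move=> u [].
- by rewrite unitmx1 invmx1.
- move=> u v [uU Pu Pu'] [vU Pv Pv'].
  rewrite unitmx_mul uU vU; split=> //; first exact: PM.
  by rewrite (_ : invmx _ = invmx v *m invmx u); [exact: PM|exact: invrM].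
- by move=> u [uU Pu Pu']; rewrite unitmx_inv invmxK.
- by move=> _ [] ->; [have [sU Vs] := invol_unitmx s_alphaK|
                      have [sU Vs] := invol_unitmx s_betaK];
    split; rewrite ?Vs.
Qed.

Lemma weyl_stable w X : weyl w -> aG2 X -> aG2 (w *m X).
Proof.
move=> Ww; move: w Ww X; apply: weyl_ind => /=.
- by move=> X; rewrite mul1mx.
- move=> _ [A [B ->]]; exists B, A; rewrite s_alphaE; congr col3; ring.
- move=> _ [A [B ->]]; exists A, (A - B); rewrite s_betaE; congr col3; ring.
- by move=> u v Hu Hv X /Hv /Hu; rewrite mulmxA.
Qed.

Let nu := col3 1 (-1) (-1).

Lemma weyl_nu w : weyl w -> w *m nu = nu \/ w *m nu = - nu.
Proof.
move: w; apply: weyl_ind => /=.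
- by left; rewrite mul1mx.
- right; rewrite s_alphaE; apply/matrixP => i j; rewrite !mxE.
  by case: i => [[|[|[|//]]]] ? /=; rewrite ?opprK.
- by left; rewrite s_betaE.
- by move=> u v Hu [Hv|Hv]; case: Hu => Hu; rewrite -mulmxA Hv ?mulmxN Hu ?opprK;
    [left|right|right|left].
Qed.

Lemma weyl_int w : weyl w -> forall i j, w i j \in Num.int.
Proof.
move: w; apply: weyl_ind => /=.
- by move=> i j; rewrite mxE; exact: rpred_nat.
- by move=> i j; rewrite mxE; case: i => [[|[|[|//]]]] ?;
    case: j => [[|[|[|//]]]] ? /=; rewrite ?rpredN ?rpred0 ?rpred1.
- by move=> i j; rewrite mxE; case: i => [[|[|[|//]]]] ?;
    case: j => [[|[|[|//]]]] ? /=; rewrite ?rpredN ?rpred0 ?rpred1.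
- by move=> u v Hu Hv i j; rewrite mxE rpred_sum // => k _; exact: rpredM.
Qed.

(* [aG2] is the orthogonal of [nu], and an element of the group maps [nu] to
   [nu] or [- nu]. Two elements with the same restriction to [aG2] but opposite
   signs on [nu] would have upper left entries that differ by 2/3, whereas all
   the entries are integers. *)
Lemma weyl_faithful w w' : weyl w -> weyl w' ->
  (forall X, aG2 X -> w *m X = w' *m X) -> w = w'.
Proof.
move=> Ww Ww' ww'.
have dec x y z : 3%:R *: col3 x y z =
    hG2 (2%:R * x + y + z) (x + 2%:R * y - z) + (x - y - z) *: nu.
  apply/matrixP=> i j; rewrite !mxE; case: i => [[|[|[|//]]]] ? /=; ring.
have ext : w *m nu = w' *m nu -> w = w'.
  move=> wnu; apply: mulmx_col_inj => X; have [x [y [z ->]]] := col3P X.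
  have n3 : (3%:R : R) != 0 by rewrite pnatr_eq0.
  apply: (scalerI n3); rewrite !scalemxAr dec !mulmxDr -!scalemxAr wnu.
  by rewrite ww' //; do 2 eexists.
have bad u u' : weyl u -> weyl u' -> (forall X, aG2 X -> u *m X = u' *m X) ->
    u *m nu = nu -> u' *m nu = - nu -> False.
  move=> Wu Wu' uu' unu u'nu.
  have : 3%:R *: (u *m col3 1 0 0 - u' *m col3 1 0 0) = 2%:R *: nu.
    rewrite scalerBr !scalemxAr dec !mulmxDr -!scalemxAr unu u'nu.
    rewrite uu'; last by do 2 eexists.
    by apply/matrixP=> i j; rewrite !mxE; ring.
  move/matrixP/(_ 0 0); rewrite !mxE !big_ord_recl !big_ord0 !mxE /=.
  have /intrP [m ->] := weyl_int Wu 0 0.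
  have /intrP [n ->] := weyl_int Wu' 0 0.
  rewrite !mulr1 !mulr0 !addr0 => e.
  have : (3%:R * (m - n))%:~R = (2%:R : int)%:~R :> R.
    by rewrite intrM rmorphB /= e.
  by move/intr_inj; lia.
case: (weyl_nu Ww) (weyl_nu Ww') => e [] e'.
- by apply: ext; rewrite e e'.
- by case: (bad w w').
- by case: (bad w' w) => // X /ww'.
- by apply: ext; rewrite e e'.
Qed.

End G2.

(* Main.v *)
Require Import Defs.
From mathcomp Require Import all_boot all_order all_algebra.
From mathcomp Require Import classical_sets reals.
From mathcomp Require Import ring lra.
Import Order.TTheory GRing.Theory Num.Theory.
Local Open Scope ring_scope.

(** Write [w] as a reduced word and induct on its length.  If [w s] is longer
    than [w], for the reflection [s] in the simple root [a], then [w a] is a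
    positive root and
    [<lambda, Y - w s Y> = <lambda, Y - w Y> + m <lambda, w a>] with [m >= 0].
    Both terms are nonnegative, so if the left-hand side vanishes, then by
    induction [w = u v] with [u] fixing [lambda] and [v] fixing [Y], and
    moreover [m = 0] or [<lambda, w a> = 0].  In the first case [s] fixes [Y]
    and [w s = u (v s)]; in the second the reflection [t = w s w^-1] fixes
    [lambda] and [w s = t w = (t u) v]. *)

Section KillingMax.
Set Implicit Arguments.
Unset Strict Implicit.
Variables (R : realType) (c : R).
Hypothesis c_gt0 : 0 < c.
Implicit Types (X Y lambda : 'cV[R]_3) (u v w : 'M[R]_3) (i j : bool).

Definition refl i : 'M[R]_3 := if i then s_beta R else s_alpha R.

(* The simple roots, as vectors, up to positive factors that depend on [c]. *)
Definition simple_root i : 'cV[R]_3 := if i then hG2 0 1 else hG2 1 (-1).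

(** The index names the rightmost letter, which the induction peels off. For [n <= 6] these
    alternating words are the reduced words of the dihedral group of order 12. *)
Fixpoint word i n : 'M[R]_3 :=
  if n is n'.+1 then word (~~ i) n' *m refl i else 1%:M.

Lemma col3D (x y z x' y' z' : R) :
  col3 x y z + col3 x' y' z' = col3 (x + x') (y + y') (z + z').
Proof. by apply/matrixP=> k l; rewrite !mxE; case: k => [[|[|[|//]]]]. Qed.

Lemma col3Z (a x y z : R) : a *: col3 x y z = col3 (a * x) (a * y) (a * z).
Proof. by apply/matrixP=> k l; rewrite !mxE; case: k => [[|[|[|//]]]]. Qed.

Lemma ip_col3 (x y z x' y' z' : R) :
  ip c (col3 x y z) (col3 x' y' z') = c * (x * x' + y * y' + z * z').
Proof. by rewrite /ip !big_ord_recl big_ord0 !mxE /= addr0 addrA. Qed.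

Lemma ipE X Y : ip c X Y = c * (X^T *m Y) 0 0.
Proof. by rewrite mxE; congr (_ * _); apply: eq_bigr => k _; rewrite mxE. Qed.

Lemma ipBr X Y Z : ip c X (Y - Z) = ip c X Y - ip c X Z.
Proof. by rewrite !ipE mulmxBr !mxE mulrBr. Qed.

Lemma ipZr a X Y : ip c X (a *: Y) = a * ip c X Y.
Proof. by rewrite !ipE -scalemxAr mxE mulrCA. Qed.

Lemma ipC X Y : ip c X Y = ip c Y X.
Proof. by congr (_ * _); apply: eq_bigr => k _; rewrite mulrC. Qed.

Lemma weyl1 : weyl (1%:M : 'M[R]_3).
Proof. by move=> G [[_ G1 _ _]]. Qed.

Lemma weylM u v : weyl u -> weyl v -> weyl (u *m v).
Proof.
by move=> Wu Wv G GP; case: (GP) => -[_ _ GM _] _; apply: GM;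
  [exact: Wu|exact: Wv].
Qed.

Lemma weylV w : weyl w -> weyl (invmx w).
Proof.
by move=> Ww G GP; case: (GP) => -[_ _ _ GV] _; apply: GV; exact: Ww.
Qed.

Lemma weyl_refl i : weyl (refl i).
Proof. by move=> G [_ sG]; apply: sG; case: i; [right|left]. Qed.

Lemma weyl_unitmx w : weyl w -> w \in unitmx.
Proof.
move: w; apply: weyl_ind => /=.
- exact: unitmx1.
- by have [] := invol_unitmx (s_alphaK R).
- by have [] := invol_unitmx (s_betaK R).
- by move=> u v uU vU; rewrite unitmx_mul uU.
Qed.

Lemma ip_weyl w X Y : weyl w -> ip c (w *m X) (w *m Y) = ip c X Y.
Proof.
move=> Ww; move: w Ww X Y; apply: weyl_ind => /=.
- by move=> X Y; rewrite !mul1mx.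
- move=> X Y; have [x [y [z ->]]] := col3P X.
  have [x' [y' [z' ->]]] := col3P Y.
  by rewrite !s_alphaE !ip_col3; ring.
- move=> X Y; have [x [y [z ->]]] := col3P X.
  have [x' [y' [z' ->]]] := col3P Y.
  by rewrite !s_betaE !ip_col3; ring.
- by move=> u v Hu Hv X Y; rewrite -!mulmxA Hu Hv.
Qed.

Lemma reflK i : refl i *m refl i = 1%:M.
Proof. by case: i; [exact: s_betaK|exact: s_alphaK]. Qed.

(** The coefficient is the value of the simple root at [hG2 A B], so [simple_root i] is exactly its
    coroot. *)
Lemma refl_hG2 i (A B : R) :
  refl i *m hG2 A B
  = hG2 A B - (if i then 2%:R * B - A else A - B) *: simple_root i.
Proof.
by case: i;
  rewrite /refl /simple_root -scaleNr col3Z col3D (s_alphaE, s_betaE);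
  congr col3; ring.
Qed.

Lemma refl_fix i X : aG2 X -> ip c (simple_root i) X = 0 -> refl i *m X = X.
Proof.
move=> [A [B ->]]; rewrite refl_hG2 => /eqP.
(* The factors [c] and [3%:R * c] are half the squared lengths of the vectors [simple_root i]. *)
rewrite (_ : ip _ _ _ =
    (if i then c else 3%:R * c) * (if i then 2%:R * B - A else A - B)).
  rewrite mulf_eq0 => /orP[|/eqP ->]; last by rewrite scale0r subr0.
  by case: i; rewrite ?mulf_eq0 ?pnatr_eq0 ?(gt_eqF c_gt0).
by case: i; rewrite /simple_root ip_col3; ring.
Qed.

Lemma refl_chamber i Y : closed_chamber Y ->
  exists2 m, 0 <= m & refl i *m Y = Y - m *: simple_root i.
Proof.
move=> [A [B [-> [_ AB B0]]]]; eexists; last exact: refl_hG2.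
by case: i; lra.
Qed.

(** For [n < 6] the word [word i n.+1] is reduced, so the image of the simple root is a positive
    root; this is checked in coordinates for each [n]. *)
Lemma ip_word_root i n lambda : closed_chamber lambda -> (n < 6)%N ->
  0 <= ip c lambda (word (~~ i) n *m simple_root i).
Proof.
move=> [A [B [-> [AB BA AB0]]]] n6.
by case: i; move: n n6 => [|[|[|[|[|[|//]]]]]] _;
  rewrite /= -?mulmxA /simple_root /hG2 !(mul1mx, s_alphaE, s_betaE) ip_col3;
  apply: (mulr_ge0 (ltW c_gt0)); lra.
Qed.

(** The braid relation: both words of length 6 equal minus the identity, even off [aG2]. *)
Lemma word6 i : word i 6 = word (~~ i) 6.
Proof.
apply: mulmx_col_inj => X; have [x [y [z ->]]] := col3P X.
by case: i; rewrite /= -!mulmxA !mul1mx !(s_alphaE, s_betaE) ?opprK.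
Qed.

Lemma word_mul_refl i n j : (n <= 6)%N ->
  exists i' n', (n' <= 6)%N /\ word i n *m refl j = word i' n'.
Proof.
have shorten k m : word k m.+1 *m refl k = word (~~ k) m.
  by rewrite /= -mulmxA reflK mulmx1.
case: n => [|n] n6; first by exists j, 1%N.
have [<-|ij] := eqVneq i j.
  by exists (~~ i), n; rewrite (ltnW n6) shorten.
have -> : i = ~~ j by case: i j ij => [] [].
(* At length 6 the braid relation makes [refl j] the last letter, which then cancels. *)
move: n6; rewrite leq_eqVlt => /orP[/eqP->|n6].
  by exists (~~ j), 5%N; rewrite -word6 shorten.
by exists j, n.+2.
Qed.

Lemma weyl_word w : weyl w -> exists i n, (n <= 6)%N /\ w = word i n.
Proof.
(* Unlike being a word, preserving the set of words under right multiplication is visibly closed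
   under products. *)
pose stable w := forall i n, (n <= 6)%N ->
  exists i' n', (n' <= 6)%N /\ word i n *m w = word i' n'.
move=> Ww; suff /(_ true 0%N isT) : stable w by rewrite mul1mx.
move: w Ww; apply: weyl_ind => /=.
- by move=> i n n6; exists i, n; rewrite mulmx1.
- by move=> i n; exact: (@word_mul_refl i n false).
- by move=> i n; exact: (@word_mul_refl i n true).
- move=> u v Hu Hv i n n6; have [i' [n' [n6' e]]] := Hu i n n6.
  by rewrite mulmxA e; exact: Hv.
Qed.

Lemma weyl_wordW i n : weyl (word i n).
Proof.
by elim: n i => [|n IH] i; [exact: weyl1|exact: weylM (weyl_refl i)].
Qed.

Lemma stabM X u v : stab X u -> stab X v -> stab X (u *m v).
Proof.
by move=> [Wu uX] [Wv vX]; split; [exact: weylM|rewrite -mulmxA vX].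
Qed.

Lemma chamber_aG2 X : closed_chamber X -> aG2 X.
Proof. by move=> [A [B [-> _]]]; exists A, B. Qed.

(** The conjugate is the reflection in the root [w *m simple_root i]. It fixes [X] because
    [invmx w *m X] is orthogonal to the simple root. *)
Lemma conj_refl_stab i w X :
  weyl w -> aG2 X -> ip c X (w *m simple_root i) = 0 ->
  stab X (w *m refl i *m invmx w).
Proof.
move=> Ww aX X0; split.
  by apply: weylM (weylV Ww); exact: weylM (weyl_refl i).
rewrite -!mulmxA refl_fix ?mulKVmx ?weyl_unitmx //.
  exact: weyl_stable (weylV Ww) aX.
by rewrite -(ip_weyl _ _ Ww) mulKVmx ?weyl_unitmx // ipC.
Qed.

(** The inequality is carried along because the equality case for a word uses it for the word
    without its last letter. *)
Lemma ip_word_le lambda Y i n : closed_chamber lambda -> closed_chamber Y ->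
  (n <= 6)%N ->
  ip c lambda (word i n *m Y) <= ip c lambda Y /\
  (ip c lambda (word i n *m Y) = ip c lambda Y ->
   mulset (stab lambda) (stab Y) (word i n)).
Proof.
move=> Cl CY; elim: n i => [|n IH] i n6 /=.
  rewrite mul1mx; split=> // _; have W1 := weyl1.
  by exists 1%:M; [|exists 1%:M]; rewrite ?mulmx1 //; split; rewrite ?mul1mx.
have [le_w eq_w] := IH (~~ i) (ltnW n6).
have Ww := weyl_wordW (~~ i) n.
have root_ge0 := ip_word_root i Cl n6.
move: (word (~~ i) n) => w in le_w eq_w Ww root_ge0 *.
have [m m_ge0 sY] := refl_chamber i CY.
have mr_ge0 := mulr_ge0 m_ge0 root_ge0.
rewrite -mulmxA sY mulmxBr ipBr -scalemxAr ipZr; split; first by lra.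
move=> e; have /eq_w[u su [v sv uvw]] : ip c lambda (w *m Y) = ip c lambda Y.
  by lra.
have /eqP : m * ip c lambda (w *m simple_root i) = 0 by lra.
rewrite mulf_eq0 => /orP[/eqP m0|/eqP l0].
- exists u => //; exists (v *m refl i); last by rewrite mulmxA uvw.
  apply: stabM => //; split; first exact: weyl_refl.
  by rewrite sY m0 scale0r subr0.
- exists (w *m refl i *m invmx w *m u).
    by apply: stabM => //; exact: conj_refl_stab Ww (chamber_aG2 Cl) l0.
  by exists v => //; rewrite -mulmxA uvw mulmxKV // weyl_unitmx.
Qed.

Lemma ip_mulset lambda Y w : mulset (stab lambda) (stab Y) w ->
  ip c lambda (w *m Y) = ip c lambda Y.
Proof.
move=> [u [Wu ul] [v [_ vY] <-]].
by rewrite -mulmxA vY -{1}ul ip_weyl.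
Qed.

End KillingMax.

Theorem propositionA13 (R : realType) (c : R) (c_gt0 : 0 < c)
    (lambda Y : 'cV[R]_3) (w : 'M[R]_3) :
  closed_chamber lambda -> closed_chamber Y -> weyl w ->
  ip c lambda (w *m Y) = ip c lambda Y
  <-> mulset (stab lambda) (stab Y) w.
Proof.
move=> Cl CY Ww; split; last exact: ip_mulset.
have [i [n [n6 ->]]] := weyl_word Ww.
by case: (ip_word_le c_gt0 i Cl CY n6).
Qed.
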